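(* Let $E$ be a nonempty subset of a Hilbert space $(X,|\cdot|)$, and let $f:E\to\mathbb{R}$, $G:E\to X$ be two functions. There exists $F\in C^{1,\omega}(X)$ such that $(F,\nabla F)=(f,G)$ on $E$ if and only if $(f,G)$ satisfies condition $(W^{1,\omega})$ on $E$ with some constant $M>0$, that is, $$f(z)\le f(y)+\tfrac12\langle G(y)+G(z),z-y\rangle+M\varphi(|y-z|)-2M\varphi^*\!\left(\frac{|G(y)-G(z)|}{2M}\right)\quad\text{for all } y,z\in E.$$ Moreover, if $(f,G)$ satisfies $(W^{1,\omega})$ with constant $M>0$, then $F$ can be chosen so that $M_\omega(\nabla F)\le \frac{16}{\sqrt3}\,M$.
   Context: Spaces are real. $\omega:[0,\infty)\to[0,\infty)$ is a modulus of continuity: a concave, increasing, continuous function with $\omega(0)=0$ and $\lim_{t\to\infty}\omega(t)=\infty$. Put $\varphi(t)=\int_0^t\omega(s)\,ds$ for $t\ge0$, and $\varphi^*(t)=\sup_{s\ge0}\{ts-\varphi(s)\}=\int_0^t\omega^{-1}(s)\,ds$ for $t\ge 0$ (the Fenchel conjugate of the even extension of $\varphi$). The dual of a Hilbert space $X$ is identified with $X$. $C^{1,\omega}(X)$ is the set of Fréchet differentiable $g:X\to\mathbb{R}$ for which there is a constant $C>0$ with $|\nabla g(x)-\nabla g(y)|\le C\,\omega(|x-y|)$ for all $x,y\in X$. For a map $H:D\to X$, $D\subseteq X$, $M_\omega(H)=\sup_{x,y\in D,\,x\ne y}\frac{|H(x)-H(y)|}{\omega(|x-y|)}$. *)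

(* Defs.v *)
From HB Require Import structures.
From mathcomp Require Import all_boot all_order all_algebra.
From mathcomp Require Import all_classical all_reals all_analysis.

Set Implicit Arguments.
Unset Strict Implicit.
Unset Printing Implicit Defensive.

Import Order.TTheory GRing.Theory Num.Theory.
Import numFieldNormedType.Exports.

Local Open Scope classical_set_scope.
Local Open Scope ring_scope.

(* Functions on [0, +oo[ are represented by total functions R -> R, of which
   only the values on [0, +oo[ are ever constrained or used. *)
Definition is_modulus (R : realType) (omega : R -> R) : Prop :=
  [/\ {in `[0, +oo[, forall t, 0 <= omega t},
      {in `[0, +oo[ &, {homo omega : s t / s < t}},
      convex_function (`[0, +oo[%classic : set R) (fun t => - omega t) &
      [/\ {within `[0, +oo[, continuous omega},
          omega 0 = 0 &
          omega t @[t --> +oo] --> +oo]].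

Definition phi (R : realType) (omega : R -> R) (t : R) : R :=
  \int[lebesgue_measure]_(s in `[0, t]) omega s.

(* The set is bounded above when omega is a modulus and 0 <= t (since omega
   tends to +oo), so the real-valued [sup] is the true supremum. *)
Definition phi_star (R : realType) (omega : R -> R) (t : R) : R :=
  sup [set t * s - phi omega s | s in `[0, +oo[].

(* A real Hilbert space is a complete normed module whose norm is induced by
   a positive definite symmetric bilinear form. *)
Definition induces_norm (R : realType) (X : completeNormedModType R)
    (ip : {dot X for idfun}) : Prop :=
  forall x : X, `|x| = Num.sqrt (ip x x).

(* The Riesz representative of the Frechet differential of F at x. It exists
   and is unique when F is differentiable at x. *)
Definition grad (R : realType) (X : completeNormedModType R)
    (ip : {dot X for idfun}) (F : X -> R) (x : X) : X :=
  get [set v | forall h, 'd F x h = ip v h].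

Definition C1omega (R : realType) (X : completeNormedModType R)
    (ip : {dot X for idfun}) (omega : R -> R) (F : X -> R) : Prop :=
  (forall x, differentiable F x) /\
  exists C : R, 0 < C /\
    forall x y, `|grad ip F x - grad ip F y| <= C * omega `|x - y|.

(* Extended-real valued: a finite upper bound says in particular that the
   supremum is finite. *)
Definition M_omega (R : realType) (X : completeNormedModType R)
    (omega : R -> R) (D : set X) (H : X -> X) : \bar R :=
  ereal_sup [set r | exists x y, [/\ D x, D y, x <> y &
    r = (`|H x - H y| / omega `|x - y|)%:E]].

Definition W1omega (R : realType) (X : completeNormedModType R)
    (ip : {dot X for idfun}) (omega : R -> R) (E : set X)
    (f : X -> R) (G : X -> X) (M : R) : Prop :=
  forall y z, E y -> E z ->
    f z <= f y + 2^-1 * ip (G y + G z) (z - y) + M * phi omega `|y - z|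
           - 2 * M * phi_star omega (`|G y - G z| / (2 * M)).

(* Main.v *)
Require Import Defs.
From HB Require Import structures.
From mathcomp Require Import all_boot all_order all_algebra.
From mathcomp Require Import all_classical all_reals all_analysis.
From mathcomp Require Import ring lra.

(** Why the theorem holds.

    Put K := 2 * M and consider, for y in E, the functions
      u_y(x) = f y + <G y, x - y> + K phi(|x - y|),
      l_y(x) = f y + <G y, x - y> - K phi(|x - y|).
    Any F lying between all the l_y and all the u_y takes the value f y and
    has the gradient G y at every y in E. Condition W gives
    l_z <= u_y: by Young's inequality for phi and its conjugate this reduces
    to an inequality of parallelogram type,
      phi(2|v|) + 2 phi(|w|) <= 2 (phi(|w + v|) + phi(|w - v|)),
    which is where the Hilbert norm and the concavity of omega are used
    ([phi_norm_parallelogram], [lower_le_upper]).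

    Call h paraconvex with constant C if it satisfies the convexity inequality
    up to an error C phi(distance to the end points). This class is stable
    under suprema, translations and convex combinations. Both l_y and - u_y
    belong to it with C = 2 K, because phi(|.|) has a gradient whose Taylor
    remainder is at most 2 phi ([phi_norm_support], [cap_paraconvex]). Let F be
    the largest paraconvex function below all the u_y. It is paraconvex as a
    supremum, and - F is paraconvex too: a convex combination of two
    translates of F, lowered by the error terms, is again paraconvex and below
    all the u_y, hence below F ([extension_paraconcave]). A locally bounded
    function that is paraconvex together with its opposite has a first-order
    Taylor expansion with remainder C phi(|h|) at every point
    ([paraconvex_taylor]); the linear part is turned into a gradient by the
    Riesz representation.

    Finally, comparing the expansions at x and y in the point
    (x + y) / 2 + w, for both signs of w, bounds <grad F y - grad F x, w>. The
    choice |w| = sqrt 3 |x - y| / 2 makes sqrt(|w|^2 + |x - y|^2 / 4) equal to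
    |x - y| and yields the modulus 4 C / sqrt 3 = 16 M / sqrt 3
    ([taylor_grad_modulus]). Conversely, for F in the class C^{1,omega} the
    mean value theorem gives such a Taylor expansion, and the same comparison,
    with w parallel to the difference of the gradients and of arbitrary
    length, is condition W ([taylor_W1omega]). *)

Set Implicit Arguments.
Unset Strict Implicit.
Unset Printing Implicit Defensive.

Import Order.TTheory GRing.Theory Num.Theory.
Import numFieldNormedType.Exports.

Local Open Scope classical_set_scope.
Local Open Scope ring_scope.

(** * The modulus omega and its primitive phi *)

Section Modulus.
Context (R : realType) (omega : R -> R) (om : is_modulus omega).

Lemma modulus_ge0 (t : R) : 0 <= t -> 0 <= omega t.
Proof. by case: om => h _ _ _ t0; apply: h; rewrite in_itv/= t0. Qed.

Lemma modulus0 : omega 0 = 0.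
Proof. by case: om => _ _ _ []. Qed.

Lemma modulus_le (s t : R) : 0 <= s -> s <= t -> omega s <= omega t.
Proof.
case: om => _ h _ _ s0; rewrite le_eqVlt => /predU1P[-> //|st].
by apply/ltW/h; rewrite // in_itv/= ?s0// (le_trans s0 (ltW st)).
Qed.

Lemma modulus_gt0 (t : R) : 0 < t -> 0 < omega t.
Proof.
move=> t0; case: om => _ h _ _; rewrite -modulus0.
by apply: h; rewrite ?in_itv/= ?lexx ?(ltW t0).
Qed.

(** Concavity together with omega 0 = 0 makes omega t / t nonincreasing; this
    is the only form in which concavity is used. *)
Lemma modulus_star_shaped (s t : R) : 0 <= s -> s <= t ->
  s * omega t <= t * omega s.
Proof.
move=> s0 st; case: om => _ _ cvx _.
have [t0|t0] := leP t 0; first by have -> : s = t by lra.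
have l01 : 0 <= s / t <= 1.
  by rewrite divr_ge0 ?(ltW t0)//= ler_pdivrMr// mul1r.
have /andP[l0 l1] := l01.
pose l : {i01 R} := Itv01 l0 l1.
have := cvx l t 0.
rewrite !inE/= !in_itv/= !andbT (ltW t0) lexx => /(_ isT isT).
rewrite !convRE/=.
have e : s / t * t + unstable.onem (s / t) * 0 = s.
  by rewrite mulr0 addr0 divfK// gt_eqF.
move=> h; have {h}: - omega (s / t * t + unstable.onem (s / t) * 0) <=
  s / t * - omega t + unstable.onem (s / t) * - omega 0 by exact: h.
rewrite e modulus0 oppr0 mulr0 addr0 mulrN lerN2 => h.
have := ler_wpM2l (ltW t0) h.
by have -> : t * (s / t * omega t) = s * omega t by field; rewrite gt_eqF.
Qed.

Lemma modulus_within_continuous (b : R) : {within `[0, b], continuous omega}.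
Proof.
case: om => _ _ _ [c _ _].
apply: continuous_subspaceW c.
by move=> x /=; rewrite !in_itv/= => /andP[->].
Qed.

Lemma is_derive_phi (t : R) : 0 < t -> is_derive t 1 (phi omega) (omega t).
Proof.
move=> t0.
have [d e] : derivable (phi omega) t 1 /\ derive1 (phi omega) t = omega t.
  apply: (@continuous_FTC1_closed R omega 0 t (t+1)) => //.
  - by rewrite ltrDl.
  - apply: continuous_compact_integrable; first exact: segment_compact.
    exact: modulus_within_continuous.
  - case: om => _ _ _ [c _ _].
    by have/continuous_within_itvcyP [+ _] := c; apply; rewrite in_itv/= t0.
by rewrite -e derive1E; apply/derivableP.
Qed.

Lemma phi_within_continuous (b : R) : 0 <= b ->
  {within `[0, b], continuous (phi omega)}.
Proof.
move=> b0; apply: parameterized_integral_continuous => //.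
apply: continuous_compact_integrable; first exact: segment_compact.
exact: modulus_within_continuous.
Qed.

Lemma phi0 : phi omega 0 = 0.
Proof. by rewrite /phi set_itv1 Rintegral_set1. Qed.

(** The quadratic correction k t^2 / 2 lets the same mean value argument
    compare phi with a tangent line (k = 0) and with a tangent parabola. *)
Lemma phi_mean_value (k s t : R) : 0 <= s -> s < t ->
  exists2 c, s < c < t &
    phi omega t - k * t ^+ 2 / 2 - (phi omega s - k * s ^+ 2 / 2)
     = (omega c - k * c) * (t - s).
Proof.
move=> s0 st.
have [||c cI e] := @MVT R (fun t => phi omega t - k * t ^+ 2 / 2)
   (fun t => omega t - k * t) s t st.
- move=> x; rewrite in_itv/= => /andP[sx xt].
  have := is_derive_phi (le_lt_trans s0 sx) => dp.
  apply: is_derive_eq.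
  rewrite /GRing.scale/=. by field.
- move=> x; apply: continuousB.
    suff h : {within `[s, t], continuous (phi omega)} by exact: h.
    have t0 := le_lt_trans s0 st.
    apply: continuous_subspaceW (phi_within_continuous (ltW t0)).
    move=> y /=; rewrite !in_itv/= => /andP[sy ->].
    by rewrite (le_trans s0 sy).
  suff : {within `[s, t], continuous (fun x => k * x ^+ 2 / 2)} by apply.
  apply: continuous_subspaceT => {}x.
  apply: cvgM; last exact: cvg_cst.
  by apply: cvgM; [exact: cvg_cst|exact: exprn_continuous].
by exists c.
Qed.

(** phi is convex since omega is nondecreasing. *)
Lemma phi_tangent (s t : R) : 0 <= s -> 0 <= t ->
  phi omega s + omega s * (t - s) <= phi omega t.
Proof.
move=> s0 t0; have [st|ts|->] := ltgtP s t.
- have [c /andP[sc ct] e] := phi_mean_value 0 s0 st.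
  have := modulus_le s0 (ltW sc); nra.
- have [c /andP[sc ct] e] := phi_mean_value 0 t0 ts.
  have := modulus_le (le_trans t0 (ltW sc)) (ltW ct); nra.
- by rewrite subrr mulr0 addr0.
Qed.

(** The derivative of u |-> phi (sqrt u) at the point u = s^2. *)
Definition sqslope (s : R) := omega s / (2 * s).

Lemma sqslopeE (s : R) : 0 < s -> omega s = 2 * s * sqslope s.
Proof. by move=> s0; rewrite /sqslope; field; rewrite gt_eqF. Qed.

Lemma sqslope_ge0 (s : R) : 0 <= s -> 0 <= sqslope s.
Proof.
by move=> s0; rewrite divr_ge0 ?mulr_ge0// modulus_ge0.
Qed.

Lemma sqslope_le (s t : R) : 0 < s -> s <= t -> sqslope t <= sqslope s.
Proof.
move=> s0 st; have t0 : 0 < t by exact: lt_le_trans st.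
rewrite /sqslope ler_pdivrMr ?mulr_gt0// mulrAC ler_pdivlMr ?mulr_gt0//.
have := modulus_star_shaped (ltW s0) st; nra.
Qed.

(** The function u |-> phi (sqrt u) is concave, since its derivative
    [sqslope] is nonincreasing. Squared Hilbert norms are affine along lines up
    to a fixed quadratic term, so this is how phi interacts with the norm. *)
Lemma phi_sq_tangent (s t : R) : 0 < s -> 0 <= t ->
  phi omega t <= phi omega s + sqslope s * (t ^+ 2 - s ^+ 2).
Proof.
move=> s0 t0; have := sqslopeE s0; set k := sqslope s => ks.
have [st|ts|->] := ltgtP s t; last by rewrite subrr mulr0 addr0.
- have [c /andP[sc ct] e] := phi_mean_value (2 * k) (ltW s0) st.
  have c0 : 0 < c by exact: lt_trans sc.
  have kc : 0 <= k - sqslope c by rewrite subr_ge0 sqslope_le// ltW.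
  have st0 : 0 <= t - s by rewrite subr_ge0 ltW.
  have := mulr_ge0 (mulr_ge0 (ltW c0) kc) st0; rewrite (sqslopeE c0) in e; nra.
- have [c /andP[sc ct] e] := phi_mean_value (2 * k) t0 ts.
  have c0 : 0 < c by exact: le_lt_trans sc.
  have kc : 0 <= sqslope c - k by rewrite subr_ge0 sqslope_le// ltW.
  have st0 : 0 <= s - t by rewrite subr_ge0 ltW.
  have := mulr_ge0 (mulr_ge0 (ltW c0) kc) st0; rewrite (sqslopeE c0) in e; nra.
Qed.

End Modulus.

(** * Scalar inequalities for phi *)

Section Scalar.
Context (R : realType) (omega : R -> R) (om : is_modulus omega).
Local Notation phi := (phi omega).
Local Notation sqslope := (sqslope omega).

Lemma phi_ge0 (t : R) : 0 <= t -> 0 <= phi t.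
Proof.
move=> t0; have := phi_tangent om (lexx 0) t0.
by rewrite phi0 (modulus0 om) mul0r addr0.
Qed.

Lemma phi_le_mul (t : R) : 0 <= t -> phi t <= t * omega t.
Proof. by move=> t0; have := phi_tangent om t0 (lexx 0); rewrite phi0; lra. Qed.

Lemma mul_le_phi (t : R) : 0 <= t -> t * omega t <= 2 * phi t.
Proof.
rewrite le_eqVlt => /predU1P[<-|t0]; first by rewrite phi0 mul0r mulr0.
have := phi_sq_tangent om t0 (lexx 0); rewrite (sqslopeE omega t0) phi0; nra.
Qed.

Lemma phi_le (s t : R) : 0 <= s -> s <= t -> phi s <= phi t.
Proof.
move=> s0 st; have := phi_tangent om s0 (le_trans s0 st).
have := mulr_ge0 (modulus_ge0 om s0) (_ : 0 <= t - s).
by rewrite subr_ge0 => /(_ st); lra.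
Qed.

Lemma phi_midpoint (s t : R) : 0 <= s -> 0 <= t ->
  2 * phi ((s + t) / 2) <= phi s + phi t.
Proof.
move=> s0 t0; have m0 : 0 <= (s + t) / 2 by lra.
have := phi_tangent om m0 s0; have := phi_tangent om m0 t0; lra.
Qed.

Lemma phi_double (t : R) : 0 <= t -> 2 * phi t <= phi (2 * t).
Proof.
move=> t0; have := @phi_midpoint 0 (2 * t) (lexx 0) _; rewrite phi0.
have -> : (0 + 2 * t) / 2 = t by field.
by rewrite add0r; apply; lra.
Qed.

(** A concave function vanishing at 0, here u |-> phi (sqrt u), is
    star-shaped. *)
Lemma phi_sq_star (a c : R) : 0 <= a -> a <= c ->
  a ^+ 2 * phi c <= c ^+ 2 * phi a.
Proof.
move=> a0 ac; have [a1|a1] := leP a 0.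
  by (have -> : a = 0 by lra); rewrite phi0; lra.
have := phi_sq_tangent om a1 (le_trans a0 ac).
have := mul_le_phi a0; rewrite (sqslopeE omega a1).
set k := sqslope a => h1 h2.
have ca : 0 <= c ^+ 2 - a ^+ 2 by nra.
have := ler_wpM2r ca h1; have := ler_wpM2l (sqr_ge0 a) h2.
nra.
Qed.

Lemma phi_sq_subadd (a b c : R) : 0 <= a -> 0 <= b -> 0 <= c ->
  c ^+ 2 <= a ^+ 2 + b ^+ 2 -> phi c <= phi a + phi b.
Proof.
move=> a0 b0 c0 h; have pa := phi_ge0 a0; have pb := phi_ge0 b0.
have [ac|ca] := leP c a; first by have := phi_le c0 ac; lra.
have [bc|cb] := leP c b; first by have := phi_le c0 bc; lra.
have := phi_sq_star a0 (ltW ca); have := phi_sq_star b0 (ltW cb).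
have c1 : 0 < c ^+ 2 by apply: exprn_gt0; lra.
move=> h1 h2; rewrite -(ler_pM2l c1).
have := ler_wpM2r (phi_ge0 c0) h; nra.
Qed.

(** For a concave function of the squares, spreading two squares apart with
    their sum fixed decreases the sum of the values. *)
Lemma phi_sq_spread (lo b a hi : R) : 0 <= lo -> lo <= b -> b <= a -> a <= hi ->
  hi ^+ 2 + lo ^+ 2 = a ^+ 2 + b ^+ 2 -> phi hi + phi lo <= phi a + phi b.
Proof.
move=> lo0 lob ba ahi e; have [b1|b1] := leP b 0.
  have -> : lo = b by lra.
  by suff -> : hi = a by []; have : (hi - a) * (hi + a) = 0; nra.
have a1 : 0 < a by lra.
have := phi_sq_tangent om a1 (_ : 0 <= hi); have := phi_sq_tangent om b1 lo0.
have := sqslope_le om b1 ba.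
have -> : lo ^+ 2 - b ^+ 2 = - (hi ^+ 2 - a ^+ 2) by lra.
move=> h1 h2 /(_ ltac:(lra)) h3.
have d0 : 0 <= hi ^+ 2 - a ^+ 2 by nra.
have := ler_wpM2r d0 h1; lra.
Qed.

Lemma phi_add_le (a b : R) : 0 <= b -> b <= a ->
  phi (a + b) <= phi a + phi b + b * omega a.
Proof.
move=> b0 ba; have [b1|b1] := leP b 0.
  by (have -> : b = 0 by lra); rewrite phi0 addr0; lra.
have a1 : 0 < a by lra.
have := phi_sq_tangent om a1 (_ : 0 <= a + b); have := sqslope_le om b1 ba.
have := mul_le_phi b0; rewrite (sqslopeE omega b1) (sqslopeE omega a1).
move=> h1 h2 /(_ ltac:(lra)) h3.
have := ler_wpM2r (sqr_ge0 b) h2; nra.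
Qed.

(** Two regimes. If (a - b) / 2 <= b, both a and b are compared with
    (a - b) / 2 by concavity in the squares. Otherwise a - 2 b >= 0; then a is
    compared with a - 2 b in the same way, and (a - b) / 2 is the midpoint of
    a - 2 b and b, where convexity applies. *)
Lemma phi_half_diff (a b : R) : 0 <= b -> b <= a ->
  b * omega a + 2 * phi ((a - b) / 2) <= phi a + phi b.
Proof.
move=> b0 ba; have [a1|a1] := leP a 0.
  have -> : b = 0 by lra. have -> : a = 0 by lra.
  by rewrite subrr !mul0r phi0; lra.
have ka := sqslope_ge0 om (ltW a1).
have [cb|bc] := leP ((a - b) / 2) b.
  have b1 : 0 < b by lra.
  have c0 : 0 <= (a - b) / 2 by lra.
  have := phi_sq_tangent om a1 c0; have := phi_sq_tangent om b1 c0.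
  have := sqslope_le om b1 ba; rewrite (sqslopeE omega a1).
  move: cb c0; set c := (a - b) / 2 => cb c0 h1 h2 h3.
  have d0 : 0 <= b ^+ 2 - c ^+ 2 by nra.
  have := ler_wpM2r d0 h1.
  have := mulr_ge0 ka (sqr_ge0 (a - b)).
  have -> : sqslope a * (a - b) ^+ 2
    = 2 * sqslope a * (a ^+ 2 + b ^+ 2 - 2 * c ^+ 2) - 4 * (a * b * sqslope a).
    by rewrite /c; field.
  lra.
have t0 : 0 <= a - 2 * b by lra.
have := phi_sq_tangent om a1 t0; have := phi_midpoint t0 b0.
have -> : (a - 2 * b + b) / 2 = (a - b) / 2 by field.
rewrite (sqslopeE omega a1).
have := mulr_ge0 ka (mulr_ge0 b0 t0); nra.
Qed.

(** The numbers a and b stand for the norms of w + v and w - v. If v <= w,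
    convexity bounds phi w and subadditivity in the squares bounds
    phi (2 v). If w < v, for fixed v and w the right-hand side is least when
    the vectors are collinear, that is for a = v + w and b = v - w, and there
    the claim is the sum of [phi_add_le] and [phi_half_diff]. *)
Lemma phi_parallelogram (v w a b : R) : 0 <= v -> 0 <= w -> 0 <= a -> 0 <= b ->
  a ^+ 2 + b ^+ 2 = 2 * (v ^+ 2 + w ^+ 2) -> a <= v + w -> b <= v + w ->
  2 * w <= a + b ->
  phi (2 * v) + 2 * phi w <= 2 * (phi a + phi b).
Proof.
move=> v0 w0 a0 b0; wlog ba : a b a0 b0 / b <= a => [hw|].
  have [ba|/ltW ab] := leP b a; first exact: hw.
  by rewrite addrC [a + b]addrC [phi a + _]addrC => *; apply: hw.
move=> e av bv wab; have [vw|wv] := leP v w.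
  have := @phi_sq_subadd a b (2 * v) a0 b0 ltac:(lra) ltac:(nra).
  have := phi_midpoint a0 b0.
  have := @phi_le w ((a + b) / 2) w0 ltac:(lra); lra.
have h1 := @phi_sq_spread (v - w) b a (v + w)
  ltac:(lra) ltac:(nra) ba av ltac:(nra).
have := @phi_add_le (v + w) (v - w) ltac:(lra) ltac:(lra).
have := @phi_half_diff (v + w) (v - w) ltac:(lra) ltac:(lra).
have -> : (v + w - (v - w)) / 2 = w by field.
have -> : v + w + (v - w) = 2 * v by ring.
lra.
Qed.

End Scalar.

(** * Behaviour at 0 and at infinity, and the conjugate *)

Section Conjugate.
Context (R : realType) (omega : R -> R) (om : is_modulus omega).

Lemma modulus_small (e : R) : 0 < e ->
  exists2 d, 0 < d & forall t, 0 <= t -> t <= d -> omega t <= e.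
Proof.
move=> e0; case: (om) => _ _ _ [c w0 _].
have /continuous_within_itvcyP [_ +] := c.
rewrite w0 => /cvgrPdist_le/(_ _ e0); rewrite near_withinE.
case=> d /= d0 h; exists (d / 2); first by rewrite divr_gt0.
move=> t t0 td; have [t1|t1] := leP t 0.
  by (have -> : t = 0 by lra); rewrite w0 ltW.
have := h t; rewrite /ball/= sub0r normrN gtr0_norm// => /(_ _ t1).
rewrite sub0r normrN ger0_norm ?modulus_ge0//; apply; lra.
Qed.

Lemma modulus_large (a : R) : exists2 s, 0 <= s & a <= omega s.
Proof.
case: (om) => _ _ _ [_ _ /cvgryPge/(_ a)[s [_ h]]].
exists (Num.max 0 s + 1); first by rewrite addr_ge0// le_max lexx.
by apply: h; rewrite (@le_lt_trans _ _ (Num.max 0 s)) ?ltrDl// le_max lexx orbT.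
Qed.

(** Because omega is unbounded, the set whose supremum is the conjugate is
    bounded above; otherwise the real supremum would be a junk value. *)
Lemma young (s t : R) : 0 <= s -> t * s - phi omega s <= phi_star omega t.
Proof.
move=> s0; apply: ub_le_sup; last by exists s => //=; rewrite in_itv/= s0.
have [r r0 tr] := modulus_large t.
exists (r * omega r) => y /= [u]; rewrite in_itv/= andbT => u0 <-.
have := phi_tangent om r0 u0; have := ler_wpM2r u0 tr.
have := phi_ge0 om r0; lra.
Qed.

Lemma phi_star_le (t b : R) : (forall s, 0 <= s -> t * s - phi omega s <= b) ->
  phi_star omega t <= b.
Proof.
move=> h; apply: ge_sup.
  by exists (t * 0 - phi omega 0); exists 0 => //=; rewrite in_itv/= lexx.
by move=> y /= [u]; rewrite in_itv/= andbT => u0 <-; exact: h.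
Qed.

End Conjugate.

(** * The inner product *)

Section Inner.
Context (R : realType) (X : completeNormedModType R) (ip : {dot X for idfun}).
Context (hip : induces_norm ip).

Lemma ipC (x y : X) : ip x y = ip y x.
Proof. by rewrite hermC/= expr0 mul1r. Qed.

Lemma ipDl (x y z : X) : ip (x + y) z = ip x z + ip y z.
Proof. exact: linearDl. Qed.

Lemma ipDr (x y z : X) : ip z (x + y) = ip z x + ip z y.
Proof. exact: linearDr. Qed.

Lemma ipZl (a : R) (x z : X) : ip (a *: x) z = a * ip x z.
Proof. exact: linearZl_LR. Qed.

Lemma ipZr (a : R) (x z : X) : ip z (a *: x) = a * ip z x.
Proof. exact: linearZr_LR. Qed.

Lemma ipNl (x z : X) : ip (- x) z = - ip x z.
Proof. exact: linearNl. Qed.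

Lemma ipNr (x z : X) : ip z (- x) = - ip z x.
Proof. exact: linearNr. Qed.

Lemma ip_norm (x : X) : ip x x = `|x| ^+ 2.
Proof.
rewrite hip sqr_sqrtr//; have [->|x0] := eqVneq x 0; first by rewrite linear0l.
by apply/ltW/neq0_dnorm_gt0.
Qed.

Lemma normD_sqr (x y : X) : `|x + y| ^+ 2 = `|x| ^+ 2 + 2 * ip x y + `|y| ^+ 2.
Proof. by rewrite -!ip_norm !ipDl !ipDr [ip y x]ipC; ring. Qed.

Lemma normB_sqr (x y : X) : `|x - y| ^+ 2 = `|x| ^+ 2 - 2 * ip x y + `|y| ^+ 2.
Proof. by rewrite normD_sqr ipNr normrN mulrN. Qed.

Lemma ip_le (x y : X) : ip x y <= `|x| * `|y|.
Proof.
have := normD_sqr x y; have := ler_normD x y.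
have := normr_ge0 (x + y); have := normr_ge0 x; have := normr_ge0 y; nra.
Qed.

Lemma ip_abs (x y : X) : `|ip x y| <= `|x| * `|y|.
Proof. by rewrite ler_norml ip_le andbT lerNl -ipNl -(normrN x) ip_le. Qed.

Lemma half_double (u : X) : 2^-1 *: (u + u) = u.
Proof.
have -> : u + u = 2 *: u by rewrite scaler_nat.
by rewrite scalerA mulVf ?pnatr_eq0// scale1r.
Qed.

(** No multiple of u = 0 has length s > 0, hence only an inequality on the
    norm of w. *)
Lemma aligned_vector (u : X) (s : R) : 0 <= s ->
  exists w : X, `|w| <= s /\ ip u w = s * `|u|.
Proof.
move=> s0; have [->|u0] := eqVneq u 0.
  by exists 0; rewrite normr0 linear0l mulr0.
have n0 : 0 < `|u| by rewrite normr_gt0.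
exists ((s / `|u|) *: u); split.
  by rewrite normrZ ger0_norm ?divr_ge0// divfK// gt_eqF.
by rewrite ipZr ip_norm; field; rewrite gt_eqF.
Qed.

Lemma norm_half (u : X) : `|2^-1 *: u| = `|u| / 2.
Proof. by rewrite normrZ ger0_norm ?invr_ge0// mulrC. Qed.

End Inner.

(** * The function phi of the norm *)

Section PhiNorm.
Context (R : realType) (omega : R -> R) (om : is_modulus omega).
Context (X : completeNormedModType R) (ip : {dot X for idfun}).
Context (hip : induces_norm ip).
Local Notation phi := (phi omega).
Local Notation sqslope := (sqslope omega).

Definition phi_grad (p : X) : X := (omega `|p| / `|p|) *: p.

(** For |h| <= |p| concavity in the squares at p suffices. For |h| > |p| it
    is applied at h instead; the worst direction is then h opposite to p,
    where convexity of phi closes the gap. *)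
Lemma phi_norm_support (p h : X) :
  phi `|p + h| <= phi `|p| + ip (phi_grad p) h + 2 * phi `|h|.
Proof.
have h0 := normr_ge0 h; have ph := phi_ge0 om h0.
have [->|p0] := eqVneq p 0.
  rewrite /phi_grad scaler0 add0r normr0 phi0 linear0l add0r add0r.
  lra.
have {}p0 : 0 < `|p| by rewrite normr_gt0.
have s0 := normr_ge0 (p + h); have e := normD_sqr hip p h.
have -> : ip (phi_grad p) h = 2 * sqslope `|p| * ip p h.
  by rewrite ipZl /sqslope; field; rewrite gt_eqF.
have k0 := sqslope_ge0 om (ltW p0).
have [hp|ph'] := leP `|h| `|p|.
  have a := phi_sq_tangent om p0 s0.
  suff b : sqslope `|p| * `|h| ^+ 2 <= phi `|h| by rewrite e in a; lra.
  have [h1|h1] := leP `|h| 0.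
    by (have -> : `|h| = 0 by lra); rewrite phi0 expr0n mulr0.
  have := mul_le_phi om h0; rewrite (sqslopeE omega h1).
  have := ler_wpM2r (sqr_ge0 `|h|) (sqslope_le om h1 hp); lra.
have h1 : 0 < `|h| by lra.
have := phi_sq_tangent om h1 s0; rewrite e.
have kk := sqslope_le om p0 (ltW ph').
have k1 := sqslope_ge0 om h0.
have := phi_tangent om (ltW p0) h0; have := mul_le_phi om (ltW p0).
rewrite (sqslopeE omega p0).
have i1 : 0 <= ip p h + `|p| * `|h|.
  by have := ip_abs hip p h; rewrite ler_norml => /andP[+ _]; lra.
have i2 : 0 <= sqslope `|p| - sqslope `|h| by lra.
have := mulr_ge0 i2 i1.
have i3 : 0 <= `|p| * (2 * `|h| - `|p|) by apply: mulr_ge0; lra.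
have := mulr_ge0 k1 i3.
lra.
Qed.

Lemma phi_norm_parallelogram (v w : X) :
  phi (2 * `|v|) + 2 * phi `|w| <= 2 * (phi `|w + v| + phi `|w - v|).
Proof.
apply: phi_parallelogram => //.
- by rewrite (normD_sqr hip) (normB_sqr hip); ring.
- by rewrite [_ + `|w|]addrC ler_normD.
- by rewrite [_ + `|w|]addrC ler_normB.
- have := ler_normD (w + v) (w - v).
  rewrite addrACA subrr addr0 -[w + w]mulr2n -scaler_nat normrZ ger0_norm//.
Qed.

(** Concavity in the squares, since |w + v|^2 and |w - v|^2 have mean r^2. *)
Lemma phi_norm_sum (v w : X) (r : R) : 0 <= r ->
  r ^+ 2 = `|w| ^+ 2 + `|v| ^+ 2 ->
  phi `|w + v| + phi `|w - v| <= 2 * phi r.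
Proof.
move=> r0 e; have e1 := normD_sqr hip w v; have e2 := normB_sqr hip w v.
have [r1|r1] := leP r 0.
  have z : r = 0 by lra.
  have e' : `|w| ^+ 2 + `|v| ^+ 2 = 0 by rewrite -e z expr0n.
  have w2 := sqr_ge0 `|w|; have v2 := sqr_ge0 `|v|.
  have wv : `|w| = 0 /\ `|v| = 0.
    by split; apply/eqP; rewrite -sqrf_eq0; apply/eqP; lra.
  case: wv => /normr0_eq0-> /normr0_eq0->.
  by rewrite subr0 add0r normr0 z; lra.
have := phi_sq_tangent om r1 (normr_ge0 (w + v)).
have := phi_sq_tangent om r1 (normr_ge0 (w - v)).
have -> : `|w + v| ^+ 2 - r ^+ 2 = 2 * ip w v by lra.
have -> : `|w - v| ^+ 2 - r ^+ 2 = - (2 * ip w v) by lra.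
lra.
Qed.

End PhiNorm.

(** * Riesz representation *)

Section Riesz.
Context (R : realType) (X : completeNormedModType R) (ip : {dot X for idfun}).
Context (hip : induces_norm ip).

(** The representative minimises J x = |x|^2 - 2 L x. By the parallelogram
    law a minimising sequence is Cauchy, and minimality at its limit v forces
    the first variation 2 (<v, h> - L h) to vanish. *)
Lemma riesz (L : X -> R) (K : R) :
  {morph L : x y / x + y} -> (forall a x, L (a *: x) = a * L x) ->
  (forall x, `|L x| <= K * `|x|) -> exists v, forall h, L h = ip v h.
Proof.
move=> LD LZ LK.
pose J x := `|x| ^+ 2 - 2 * L x.
have JD x h t : J (x + t *: h) =
    J x + 2 * t * (ip x h - L h) + t ^+ 2 * `|h| ^+ 2.
  rewrite /J (normD_sqr hip) LD LZ ipZr normrZ exprMn real_normK ?num_real//.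
  by ring.
have Jlb x : - K ^+ 2 <= J x.
  have := LK x; rewrite ler_norml => /andP[_ h].
  have := sqr_ge0 (`|x| - K); rewrite /J; lra.
have Jinf : has_inf (range J).
  by split; [exists (J 0); exists 0|exists (- K ^+ 2) => _ [x _ <-]].
pose i := inf (range J).
have iJ x : i <= J x by apply: ge_inf; [case: Jinf|exists x].
have Jpar x y : `|x - y| ^+ 2 <= 2 * (J x - i) + 2 * (J y - i).
  have := iJ (2^-1 *: (x + y)); rewrite /J LZ LD normrZ.
  rewrite gtr0_norm ?invr_gt0// exprMn (normD_sqr hip) (normB_sqr hip).
  lra.
have Jn (n : nat) : exists x, J x < i + n.+1%:R^-1.
  have [|_ [x _ <-] h] := @inf_adherent _ (range J) n.+1%:R^-1 _ Jinf.
    by rewrite invr_gt0.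
  by exists x.
have [u Ju] := choice Jn.
have ucvg : cvg (u @ \oo).
  apply/cauchy_cvgP/cauchy_exP => e e0.
  have e1 : 0 < e ^+ 2 / 4 by rewrite divr_gt0// exprn_gt0.
  have [N _ HN] := near_infty_natSinv_lt (PosNum e1).
  exists (u N); exists N => // n /= Nn.
  rewrite -ball_normE/= -(ltr_pXn2r (_ : 0 < 2)%N) ?nnegrE// ?(ltW e0)//.
  apply: le_lt_trans (Jpar _ _) _.
  have := Ju n; have := Ju N; have /= := HN _ Nn; have /= := HN _ (leqnn N).
  move: (N.+1%:R^-1) (n.+1%:R^-1) => a b; lra.
have Jlim d : 0 < d -> exists2 x, `|x - lim (u @ \oo)| <= d & J x <= i + d.
  move=> d0; have [N _ HN] := near_infty_natSinv_lt (PosNum d0).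
  have /cvgrPdist_le/(_ _ d0)[M _ HM] := ucvg.
  exists (u (maxn N M)); first by rewrite distrC HM//= leq_maxr.
  have := Ju (maxn N M); have /= := HN _ (leq_maxl N M).
  move: ((maxn N M).+1%:R^-1) => a; lra.
exists (lim (u @ \oo)) => h; set v := lim _ in Jlim *.
suff key t : 0 <= 2 * t * (ip v h - L h) + t ^+ 2 * `|h| ^+ 2.
  set a := ip v h - L h in key *; set q := `|h| ^+ 2 in key *.
  have q0 : 0 <= q by exact: sqr_ge0.
  (* This t is close to the minimiser - a / q of 2 t a + t^2 q, and makes
     sense for q = 0. *)
  have := key (- a / (q + 1)).
  have -> : 2 * (- a / (q + 1)) * a + (- a / (q + 1)) ^+ 2 * q =
    - (a ^+ 2 * (q + 2) / (q + 1) ^+ 2).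
    by field; rewrite gt_eqF// ltr_wpDl.
  rewrite oppr_ge0 pmulr_lle0 ?invr_gt0 ?exprn_gt0 ?ltr_wpDl//.
  rewrite pmulr_lle0 ?ltr_wpDl// => a2.
  have /eqP : a ^+ 2 = 0 by apply/eqP; rewrite eq_le a2 sqr_ge0.
  by rewrite sqrf_eq0 /a subr_eq0 => /eqP.
apply/ler_addgt0Pr => e e0.
pose d := e / (1 + 2 * `|t| * `|h|).
have c0 : 0 < 1 + 2 * `|t| * `|h| by rewrite ltr_wpDr// !mulr_ge0.
have d0 : 0 < d by rewrite divr_gt0.
have [x xv Jx] := Jlim d d0.
have := iJ (x + t *: h); rewrite JD.
have : 2 * t * (ip x h - ip v h) <= 2 * `|t| * (d * `|h|).
  apply: le_trans (ler_norm _) _; rewrite !normrM (ger0_norm (_ : 0 <= 2))//.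
  rewrite ler_wpM2l ?mulr_ge0// -ipNl -ipDl.
  by apply: le_trans (ip_abs hip _ _) _; rewrite ler_wpM2r.
have : d * (1 + 2 * `|t| * `|h|) = e by rewrite /d divfK// gt_eqF.
lra.
Qed.

End Riesz.

(** * Gradients and Taylor expansions *)

Section Gradient.
Context (R : realType) (X : completeNormedModType R) (ip : {dot X for idfun}).
Context (hip : induces_norm ip).

(** The inner product with v, declared linear for the scaling of R as a normed
    module over itself, which is what differentials require. *)
Definition ip_form (v : X) : X -> R := fun h => ip v h.

Fact ip_form_linear (v : X) : linear (ip_form v).
Proof. by move=> a x y; rewrite /ip_form linearDr linearZr_LR. Qed.

HB.instance Definition _ (v : X) :=
  GRing.isLinear.Build R X R *:%R (ip_form v) (ip_form_linear v).

Lemma ip_inj (u v : X) : (forall h, ip u h = ip v h) -> u = v.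
Proof.
move=> h; apply/eqP; rewrite -subr_eq0 -normr_eq0 -sqrf_eq0 -(ip_norm hip).
by rewrite ipDl ipNl h subrr.
Qed.

Lemma ip_form_continuous (v : X) : continuous (ip_form v).
Proof.
move=> x; apply/cvgrPdist_le => e e0; near=> y.
rewrite /ip_form -ipNr -ipDr; apply: le_trans (ip_abs hip _ _) _.
apply: (@le_trans _ _ ((`|v| + 1) * `|x - y|)).
  by rewrite ler_wpM2r// lerDl.
rewrite mulrC -ler_pdivlMr ?ltr_wpDl//.
near: y; apply: cvgr_dist_le; first exact: cvg_id.
by rewrite divr_gt0// ltr_wpDl.
Unshelve. all: by end_near. Qed.

Lemma gradE (F : X -> R) (x h : X) : differentiable F x ->
  'd F x h = ip (grad ip F x) h.
Proof.
move=> dF.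
have [K K0 LK] : exists2 K, 0 < K & forall h, `|'d F x h| <= K * `|h|.
  exact/linear_lipschitz/diff_continuous.
have LZ a y : 'd F x (a *: y) = a * 'd F x y by rewrite linearZ.
have [v vh] := @riesz R X ip hip ('d F x) K (linearD _) LZ LK.
have : [set v | forall h, 'd F x h = ip v h] (grad ip F x).
  by apply: getPex; exists v.
by apply.
Qed.

Lemma grad_eq (F : X -> R) (x v : X) : differentiable F x ->
  (forall h, 'd F x h = ip v h) -> grad ip F x = v.
Proof. by move=> dF h; apply: ip_inj => k; rewrite -gradE// h. Qed.

Lemma taylor_differentiable (omega : R -> R) (F : X -> R) (x v : X) (C : R) :
  is_modulus omega ->
  (forall h, `|F (x + h) - F x - ip v h| <= C * phi omega `|h|) ->
  differentiable F x /\ grad ip F x = v.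
Proof.
move=> om Fv; have taylor : F \o shift x = cst (F x) + ip_form v +o_ 0 id.
  apply/eqaddoP => e e0.
  have e1 : 0 < e / (`|C| + 1) by rewrite divr_gt0// ltr_wpDl.
  have [d d0 hd] := modulus_small om e1.
  near=> h; rewrite /cst /ip_form/= -[X in `|X|]/(F (h + x) - (F x + ip v h)).
  rewrite opprD addrA [h + x]addrC.
  apply: le_trans (Fv h) _.
  have hd' : `|h| <= d.
    by near: h; apply/nbhs_norm0P; exists d => //= y /=; exact: ltW.
  have := phi_le_mul om (normr_ge0 h); have := hd _ (normr_ge0 h) hd'.
  rewrite ler_pdivlMr ?ltr_wpDl// => h1 h2.
  have p0 := phi_ge0 om (normr_ge0 h).
  have c0 : 0 <= `|C| by [].
  have w0 := modulus_ge0 om (normr_ge0 h).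
  apply: (@le_trans _ _ (`|C| * phi omega `|h|)).
    by rewrite ler_wpM2r// ler_norm.
  apply: (@le_trans _ _ (`|C| * (`|h| * omega `|h|))); first exact: ler_wpM2l.
  have := ler_wpM2l (normr_ge0 h) h1; have := mulr_ge0 (normr_ge0 h) w0; lra.
have dE : 'd F x = ip_form v :> (X -> R).
  exact: (@diff_unique R X R F (ip_form v) x (@ip_form_continuous v) taylor).
have dF : differentiable F x.
  apply/diff_locallyP; split; first by rewrite dE; exact: ip_form_continuous.
  by rewrite dE.
by split=> //; apply: grad_eq => // h; rewrite dE.
Unshelve. all: by end_near. Qed.

(** Differentiability of F along a line is read off from its directional
    derivatives: the difference quotients of t |-> F (x + t h) at t are those
    of F at x + t h in the direction h. *)
Lemma mean_value (F : X -> R) (x h : X) : (forall y, differentiable F y) ->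
  exists2 c, 0 <= c <= 1 & F (x + h) - F x = ip (grad ip F (x + c *: h)) h.
Proof.
move=> dF; pose g (t : R) := x + t *: h.
have shiftE (t : R) :
    (fun s : R => s^-1 *: (((F \o g) \o shift t) (s *: 1) - (F \o g) t))
    = (fun s : R => s^-1 *: ((F \o shift (g t)) (s *: h) - F (g t))).
  apply/funext => s /=; congr (_ *: (F _ - _)).
  by rewrite /g [s *: 1]mulr1 scalerDl addrCA.
have dFg (t : R) : is_derive t 1 (F \o g) (ip (grad ip F (g t)) h).
  split; first by rewrite /derivable shiftE; exact: diff_derivable.
  by rewrite /derive shiftE -gradE// -deriveE.
have [|c cI e] := MVT_segment ler01 (fun t _ => dFg t).
  by apply: derivable_within_continuous => t _; case: (dFg t).
exists c; first by move: cI; rewrite in_itv.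
by move: e; rewrite /g/= scale1r scale0r addr0 subr0 mulr1.
Qed.

End Gradient.

(** * Paraconvex functions *)

Section Paraconvex.
Context (R : realType) (omega : R -> R) (om : is_modulus omega).
Context (X : completeNormedModType R) (ip : {dot X for idfun}).
Context (hip : induces_norm ip).
Local Notation phi := (phi omega).

(** The point p is the convex combination of p + d and p + e with weights l
    and 1 - l. An inequality with two end points is stable under suprema,
    translations and convex combinations, and weak enough to follow from a
    supporting function with error C phi. *)
Definition paraconvex (C : R) (h : X -> R) := forall (p d e : X) (l : R),
  0 <= l <= 1 -> l *: d + (1 - l) *: e = 0 ->
  h p <= l * (h (p + d) + C * phi `|d|) + (1 - l) * (h (p + e) + C * phi `|e|).

(** phi (s r) = o(s) as s tends to 0. *)
Lemma slope_le0 (r K a : R) : 0 <= r -> 0 <= K ->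
  (forall s, 0 < s -> s * a <= K * phi (s * r)) -> a <= 0.
Proof.
move=> r0 K0 h; rewrite leNgt; apply/negP => a0.
have e0 : 0 < a / (K * r + 1) by rewrite divr_gt0// ltr_wpDl// mulr_ge0.
have [d d0 hd] := modulus_small om e0.
have s0 : 0 < d / (r + 1) by rewrite divr_gt0// ltr_wpDl.
have sr0 : 0 <= d / (r + 1) * r by rewrite mulr_ge0// ltW.
have srd : d / (r + 1) * r <= d.
  by rewrite mulrAC ler_pdivrMr ?ltr_wpDl// ler_wpM2l ?(ltW d0)// lerDl.
have := h _ s0; have := phi_le_mul om sr0; have := hd _ sr0 srd.
set s := d / (r + 1) in s0 sr0 srd *; set w := omega _; set q := phi _.
rewrite ler_pdivlMr ?ltr_wpDl ?mulr_ge0// => h1 h2 h3.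
have : s * a <= s * (K * r * w).
  by apply: le_trans h3 _; have := ler_wpM2l K0 h2; lra.
rewrite ler_pM2l// => h4.
have w0 : 0 <= w by exact: modulus_ge0.
have w1 : w <= 0 by lra.
have wz : w = 0 by lra.
by move: h4; rewrite wz mulr0; lra.
Qed.

(** By [phi_norm_support], such a function is at least its tangent affine map
    at p minus 2 K phi of the distance to p. Averaging this lower bound over
    the two end points cancels the linear part. *)
Lemma cap_paraconvex (a : R) (v y : X) (K : R) : 0 <= K ->
  paraconvex (2 * K) (fun x => a + ip v (x - y) - K * phi `|x - y|).
Proof.
move=> K0 p d e l /andP[l0 l1] z; pose N := phi_grad omega (p - y).
have support u : a + ip v (p - y) - K * phi `|p - y| + (ip v u - K * ip N u)
    <= a + ip v (p + u - y) - K * phi `|p + u - y| + 2 * K * phi `|u|.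
  have := ler_wpM2l K0 (phi_norm_support om hip (p - y) u); rewrite -/N.
  have -> : p + u - y = p - y + u by rewrite addrAC.
  by rewrite (ipDr _ (p - y) u); lra.
have l1' : 0 <= 1 - l by rewrite subr_ge0.
have := ler_wpM2l l0 (support d); have := ler_wpM2l l1' (support e).
have ip0 w : l * ip w d + (1 - l) * ip w e = 0.
  by rewrite -!ipZr -ipDr z linear0r.
have := ip0 v; have /(congr1 ( *%R K)) := ip0 N; lra.
Qed.

Section Differentiability.
Context (C : R) (C0 : 0 <= C) (F : X -> R).
Context (Fcvx : paraconvex C F) (Fccv : paraconvex C (fun x => - F x)).

Definition is_slope (p h : X) (L : R) := forall s, 0 < s ->
  `|F (p + s *: h) - F p - s * L| <= C * phi (s * `|h|) /\
  `|F p - F (p - s *: h) - s * L| <= C * phi (s * `|h|).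

Lemma normZ_pos (s : R) (h : X) : 0 < s -> `|s *: h| = s * `|h|.
Proof. by move=> s0; rewrite normrZ gtr0_norm. Qed.

Lemma paraconvex_line (G : X -> R) (p h : X) (s t : R) : paraconvex C G ->
  0 < s -> 0 < t -> (s + t) * G p <=
    t * (G (p + s *: h) + C * phi (s * `|h|))
    + s * (G (p - t *: h) + C * phi (t * `|h|)).
Proof.
move=> Gcvx s0 t0; have st0 : 0 < s + t by lra.
have l01 : 0 <= t / (s + t) <= 1.
  by rewrite divr_ge0 ?(ltW t0) ?(ltW st0)//= ler_pdivrMr// mul1r; lra.
have z : (t / (s + t)) *: (s *: h) + (1 - t / (s + t)) *: - (t *: h) = 0.
  rewrite -[- (t *: h)]scaleNr !scalerA -scalerDl.
  have -> : t / (s + t) * s + (1 - t / (s + t)) * - t = 0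
    by field; rewrite gt_eqF.
  by rewrite scale0r.
have := @Gcvx p _ _ _ l01 z.
rewrite normrN !normZ_pos// => hh.
have := ler_wpM2l (ltW st0) hh.
have -> : forall a b, (s + t) * (t / (s + t) * a + (1 - t / (s + t)) * b)
  = t * a + s * b by move=> a b; field; rewrite gt_eqF.
by [].
Qed.

(** Paraconvexity of F and of - F says that the forward quotients A s / s
    and the backward quotients B t / t differ by at most
    E s / s + E t / t. The infimum of the forward quotients corrected by their
    error is therefore within the error of all quotients. *)
Lemma slope_exists (p h : X) : exists L, is_slope p h L.
Proof.
pose A s := F (p + s *: h) - F p; pose B s := F p - F (p - s *: h).
pose E s := C * phi (s * `|h|).
have AB s t : 0 < s -> 0 < t -> s * (B t - E t) <= t * (A s + E s).
  move=> s0 t0; have := paraconvex_line p h Fcvx s0 t0; rewrite /A /B /E; lra.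
have BA s t : 0 < s -> 0 < t -> t * (A s - E s) <= s * (B t + E t).
  move=> s0 t0; have := paraconvex_line p h Fccv s0 t0; rewrite /A /B /E; lra.
pose S := [set (A s + E s) / s | s in `]0, +oo[%classic].
have Slb t : 0 < t -> lbound S ((B t - E t) / t).
  move=> t0 y [s /= +] <-; rewrite in_itv/= andbT => s0.
  by rewrite ler_pdivrMr// mulrAC ler_pdivlMr// mulrC [_ * t]mulrC AB.
have S0 : S !=set0.
  by exists ((A 1 + E 1) / 1); exists 1; rewrite //= in_itv/= ltr01.
pose L := inf S.
have LA s : 0 < s -> s * L <= A s + E s.
  move=> s0; rewrite mulrC -ler_pdivlMr//; apply: ge_inf; last first.
    by exists s; rewrite //= in_itv/= s0.
  by exists ((B 1 - E 1) / 1); apply: Slb.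
have LB t : 0 < t -> B t - E t <= t * L.
  move=> t0; rewrite mulrC -ler_pdivrMr//.
  by apply: lb_le_inf => //; exact: Slb.
(* The backward quotient at t serves as an intermediary, and its error is
   removed by letting t tend to 0. *)
have LA' s : 0 < s -> A s - E s <= s * L.
  move=> s0; rewrite -subr_le0.
  apply: (@slope_le0 `|h| (s * (2 * C))) => //.
    by rewrite !mulr_ge0// ltW.
  move=> t t0; have := BA s t s0 t0; have := LB t t0; rewrite -/(E t).
  have -> : s * (2 * C) * phi (t * `|h|) = 2 * s * E t by rewrite /E; ring.
  by move=> /(ler_wpM2l (ltW s0)); lra.
have LB' t : 0 < t -> t * L <= B t + E t.
  move=> t0; rewrite -subr_le0.
  apply: (@slope_le0 `|h| (t * (2 * C))) => //.
    by rewrite !mulr_ge0// ltW.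
  move=> s s0; have := BA s t s0 t0; have := LA s s0; rewrite -/(E t).
  have -> : t * (2 * C) * phi (s * `|h|) = 2 * t * E s by rewrite /E; ring.
  by move=> /(ler_wpM2l (ltW t0)); lra.
exists L => s s0; rewrite -/(A s) -/(B s) -/(E s) !ler_norml.
have := LA s s0; have := LB s s0; have := LA' s s0; have := LB' s s0.
by move=> *; split; apply/andP; split; lra.
Qed.

Lemma slope_unique (p h : X) (L L' : R) :
  is_slope p h L -> is_slope p h L' -> L = L'.
Proof.
suff le (l l' : R) : is_slope p h l -> is_slope p h l' -> l <= l'.
  by move=> hL hL'; apply/eqP; rewrite eq_le !le.
move=> hl hl'; rewrite -subr_le0; apply: (@slope_le0 `|h| (2 * C)) => //.
  by rewrite mulr_ge0.
move=> s s0; have [+ _] := hl s s0; have [+ _] := hl' s s0.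
by rewrite !ler_norml => /andP[? ?] /andP[? ?]; lra.
Qed.

Definition slope (p h : X) : R := xget 0 [set L | is_slope p h L].

Lemma slopeP (p h : X) : is_slope p h (slope p h).
Proof.
by have [L hL] := slope_exists p h; rewrite /slope; case: xgetP => // /(_ L).
Qed.

Lemma slope_eq (p h : X) (L : R) : is_slope p h L -> slope p h = L.
Proof. exact/slope_unique/slopeP. Qed.

Lemma slopeZ (p h : X) (a : R) : slope p (a *: h) = a * slope p h.
Proof.
apply: slope_eq => s s0; have [a0|a0|->] := ltgtP a 0; last first.
- rewrite scale0r scaler0 addr0 subr0 subrr mul0r !mulr0 subr0 !normr0.
  by rewrite mulr0 phi0 mulr0.
- have [h1 h2] := slopeP p h (mulr_gt0 s0 a0).
  by rewrite scalerA normZ_pos// !mulrA.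
- have sa : 0 < s * - a by rewrite mulr_gt0// oppr_gt0.
  have [h1 h2] := slopeP p h sa.
  rewrite normrZ ltr0_norm// !mulrA; rewrite mulrN scaleNr opprK in h1 h2.
  rewrite scalerA; rewrite mulrN.
  split.
    move: h2; rewrite -[X in _ -> X <= _]normrN; congr (`|_| <= _); ring.
  move: h1; rewrite -[X in _ -> X <= _]normrN; congr (`|_| <= _); ring.
Qed.

(** Paraconvexity of F and - F at the midpoint p + s (h + k) of
    p + 2 s h and p + 2 s k shows that the slopes are additive up to
    O(phi(s r)) / s, which tends to 0 with s. *)
Lemma slopeD (p h k : X) : slope p (h + k) = slope p h + slope p k.
Proof.
have mid (G : X -> R) s : paraconvex C G -> 0 < s ->
  2 * G (p + s *: (h + k)) <= G (p + (2 * s) *: h) + G (p + (2 * s) *: k)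
    + 2 * C * phi (s * `|h - k|).
  move=> Gcvx s0.
  have := @Gcvx (p + s *: (h + k)) (s *: (h - k)) (- (s *: (h - k))) 2^-1.
  have -> : p + s *: (h + k) + s *: (h - k) = p + (2 * s) *: h.
    rewrite -addrA -scalerDr addrACA subrr addr0 -mulr2n -scaler_nat scalerA.
    by rewrite [s * _]mulrC.
  have -> : p + s *: (h + k) - s *: (h - k) = p + (2 * s) *: k.
    rewrite -addrA -scalerBr opprB [h + k]addrC addrACA subrr addr0.
    rewrite -mulr2n -scaler_nat scalerA.
    by rewrite [s * _]mulrC.
  rewrite normrN normZ_pos//.
  have half : 1 - 2^-1 = 2^-1 :> R by field.
  rewrite half -scalerDr subrr scaler0.
  have -> : 0 <= (2^-1 : R) <= 1 by rewrite invr_ge0 ler0n/= invf_le1// ler1n.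
  by move=> /(_ isT erefl); lra.
have nn := normr_ge0 h; have nk := normr_ge0 k.
have bound s : 0 < s ->
  `|s * (slope p (h + k) - slope p h - slope p k)| <=
   3 * C * phi (s * (2 * `|h| + 2 * `|k|)).
  move=> s0; have s2 : 0 < 2 * s by lra.
  have [+ _] := slopeP p h s2; have [+ _] := slopeP p k s2.
  have [+ _] := slopeP p (h + k) s0.
  have := mid _ s Fcvx s0; have := mid _ s Fccv s0.
  set q := phi (s * (_ + _)).
  have le u : 0 <= u -> u <= 2 * `|h| + 2 * `|k| -> C * phi (s * u) <= C * q.
    move=> u0 ule; rewrite ler_wpM2l//; apply: phi_le => //.
      by rewrite mulr_ge0// ltW.
    by rewrite ler_wpM2l// ltW.
  have := le `|h - k| (normr_ge0 _) ltac:(by have := ler_normB h k; lra).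
  have := le `|h + k| (normr_ge0 _) ltac:(by have := ler_normD h k; lra).
  have := le (2 * `|h|) ltac:(lra) ltac:(lra).
  have := le (2 * `|k|) ltac:(lra) ltac:(lra).
  have -> : s * (2 * `|h|) = 2 * s * `|h| by ring.
  have -> : s * (2 * `|k|) = 2 * s * `|k| by ring.
  rewrite !ler_norml => ? ? ? ? ? ? /andP[? ?] /andP[? ?] /andP[? ?].
  by apply/andP; split; lra.
have r0 : 0 <= 2 * `|h| + 2 * `|k| by lra.
have K0 : 0 <= 3 * C by rewrite mulr_ge0.
apply/eqP; rewrite eq_le -subr_le0 opprD addrA (slope_le0 r0 K0)/=; last first.
  by move=> s s0; apply: le_trans (bound s s0); exact: ler_norm.
rewrite -subr_le0 (slope_le0 r0 K0)// => s s0.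
apply: le_trans (bound s s0); rewrite -normrN.
by apply: le_trans (ler_norm _); lra.
Qed.

Lemma paraconvex_taylor (p : X) (B : R) :
  (forall h, `|h| <= 1 -> `|F (p + h)| <= B) ->
  exists v, forall h, `|F (p + h) - F p - ip v h| <= C * phi `|h|.
Proof.
move=> Fb.
have T h : `|F (p + h) - F p - slope p h| <= C * phi `|h|.
  by have [+ _] := slopeP p h ltr01; rewrite scale1r !mul1r.
have [|v hv] := @riesz R X ip hip (slope p) (2 * B + C * phi 1) (slopeD p)
  (fun a x => slopeZ p x a).
  move=> x; have [->|x0] := eqVneq x 0.
    by have := slopeZ p 0 0; rewrite scale0r mul0r => ->; rewrite !normr0 mulr0.
  have n0 : 0 < `|x| by rewrite normr_gt0.
  have n1 : `| `|x|^-1 *: x| = 1.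
    by rewrite normrZ normfV normr_id mulVf// gt_eqF.
  have -> : slope p x = `|x| * slope p (`|x|^-1 *: x).
    by rewrite -slopeZ scalerA divff ?gt_eqF// scale1r.
  rewrite normrM normr_id mulrC ler_wpM2r//.
  have := T (`|x|^-1 *: x); rewrite n1.
  have := Fb (`|x|^-1 *: x); rewrite n1 => /(_ (lexx _)).
  have := Fb 0; rewrite normr0 addr0 => /(_ ler01).
  rewrite !ler_norml => /andP[? ?] /andP[? ?] /andP[? ?].
  by apply/andP; split; lra.
by exists v => h; rewrite -hv.
Qed.

End Differentiability.
End Paraconvex.

(** * Consequences of a Taylor expansion with remainder C phi *)

Section Taylor.
Context (R : realType) (omega : R -> R) (om : is_modulus omega).
Context (X : completeNormedModType R) (ip : {dot X for idfun}).
Context (hip : induces_norm ip).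
Local Notation phi := (phi omega).

Definition taylor_bound (C : R) (F : X -> R) (g : X -> X) :=
  forall x h, `|F (x + h) - F x - ip (g x) h| <= C * phi `|h|.

(** The remainder is at most C |h| omega(|h|) by the mean value theorem, and
    t omega t <= 2 phi t by concavity. *)
Lemma C1omega_taylor (F : X -> R) : C1omega ip omega F ->
  exists2 C, 0 < C & taylor_bound C F (grad ip F).
Proof.
case=> dF [C [C0 gC]]; exists (2 * C) => [|x h]; first by rewrite mulr_gt0.
have [c /andP[c0 c1] ->] := mean_value hip x h dF.
rewrite -ipNl -ipDl; apply: le_trans (ip_abs hip _ _) _.
have h0 := normr_ge0 h.
have /(ler_wpM2r h0) :
    `|grad ip F (x + c *: h) - grad ip F x| <= C * omega `|h|.
  apply: le_trans (gC _ _) _; rewrite ler_pM2l// addrAC subrr add0r.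
  apply: modulus_le => //; rewrite normrZ ger0_norm//; nra.
have := ler_wpM2l (ltW C0) (mul_le_phi om h0); lra.
Qed.

Context (C : R) (C0 : 0 < C) (F : X -> R) (g : X -> X).
Context (Fg : taylor_bound C F g).

(** The expansions at x and at y are compared at the common point
    (x + y) / 2 + w = x + (w - d) = y + (w + d). *)
Lemma taylor_pair (x y w : X) (d := 2^-1 *: (x - y)) :
  F y - F x + ip (g y + g x) d + ip (g y - g x) w
    <= C * (phi `|w + d| + phi `|w - d|).
Proof.
have ex : x + (w - d) = y + (w + d).
  have -> : x = y + (d + d).
    rewrite /d -scalerDl (_ : 2^-1 + 2^-1 = 1); last by field.
    by rewrite scale1r addrC subrK.
  by rewrite -addrA; congr (y + _); rewrite [w - d]addrC addrA addrK addrC.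
have := Fg x (w - d); have := Fg y (w + d); rewrite ex !ler_norml.
move=> /andP[h1 _] /andP[_ h2].
rewrite !ipDl !ipDr ?ipNr ?ipNl in h1 h2 *; lra.
Qed.

(** Taking w along g z - g y and of norm at most s in [taylor_pair] gives a
    bound for every s >= 0; its supremum over s is the conjugate term. *)
Lemma taylor_W1omega (E : set X) : W1omega ip omega E F g C.
Proof.
move=> y z _ _; set D := `|g y - g z|; set t := `|y - z|.
have C2 : 0 < 2 * C by rewrite mulr_gt0.
have h s : 0 <= s -> s * D - 2 * C * phi s <=
    F y + 2^-1 * ip (g y + g z) (z - y) + C * phi t - F z.
  move=> s0; have [w [ws ew]] := aligned_vector hip (g z - g y) s0.
  have /= := taylor_pair y z w; set d := 2^-1 *: _.
  rewrite ew distrC -/D.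
  have -> : ip (g z + g y) d = - (2^-1 * ip (g y + g z) (z - y)).
    by rewrite ipZr -opprB ipNr [g z + _]addrC; ring.
  have dt : `|d| = t / 2 by rewrite norm_half.
  have r0 : 0 <= Num.sqrt (`|w| ^+ 2 + `|d| ^+ 2) by [].
  have re : Num.sqrt (`|w| ^+ 2 + `|d| ^+ 2) ^+ 2 = `|w| ^+ 2 + `|d| ^+ 2.
    by rewrite sqr_sqrtr// addr_ge0 ?sqr_ge0.
  have h1 := phi_norm_sum om hip r0 re.
  have h2 := phi_sq_subadd om (normr_ge0 w) (normr_ge0 d) r0.
  rewrite re in h2; have {}h2 := h2 (lexx _).
  have h3 := phi_le om (normr_ge0 w) ws.
  have d0 : 0 <= t / 2 by rewrite -dt.
  have := phi_double om d0; rewrite -dt.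
  have -> : 2 * `|d| = t by rewrite dt mulrC divfK ?pnatr_eq0.
  move=> h4 h5.
  have : phi `|w + d| + phi `|w - d| <= 2 * phi s + phi t by lra.
  by move=> /(ler_wpM2l (ltW C0)); lra.
have : phi_star omega (D / (2 * C)) <=
  (F y + 2^-1 * ip (g y + g z) (z - y) + C * phi t - F z) / (2 * C).
  apply: phi_star_le => s s0; rewrite ler_pdivlMr//.
  have -> : (D / (2 * C) * s - phi s) * (2 * C) = s * D - 2 * C * phi s.
    by field; rewrite gt_eqF.
  exact: h.
rewrite ler_pdivlMr// mulrC; lra.
Qed.

(** Adding [taylor_pair] for (x, y, w) and for (y, x, - w) cancels the values
    of F. For w along g y - g x with |w| = sqrt 3 |d|, the sum of the squares
    of the norms of w and d is 4 |d|^2 = |x - y|^2. *)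
Lemma taylor_grad_modulus (x y : X) :
  `|g x - g y| <= 4 / Num.sqrt 3 * C * omega `|x - y|.
Proof.
have [->|xy] := eqVneq x y.
  by rewrite !subrr !normr0 (modulus0 om) mulr0.
set t := `|x - y|; have t0 : 0 < t by rewrite normr_gt0 subr_eq0.
have q0 : 0 < Num.sqrt 3 :> R by rewrite sqrtr_gt0.
have q2 : Num.sqrt 3 ^+ 2 = 3 :> R by rewrite sqr_sqrtr.
move: (Num.sqrt 3) q0 q2 => q q0 q2.
pose d := 2^-1 *: (x - y); have dt : `|d| = t / 2 by rewrite norm_half.
have s0 : 0 <= q * (t / 2) by rewrite mulr_ge0 ?(ltW q0)// divr_ge0 ?(ltW t0).
have [w [ws ew]] := aligned_vector hip (g y - g x) s0.
have /= h1 := taylor_pair x y w; rewrite -/d in h1.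
have /= h2 := taylor_pair y x (- w).
have dE : 2^-1 *: (y - x) = - d by rewrite /d -scalerN opprB.
rewrite dE opprK -opprD in h2.
have nE : `|- w + d| = `|w - d| by rewrite -normrN opprD opprK.
rewrite normrN nE in h2.
have h3 : ip (g y - g x) w <= C * (phi `|w + d| + phi `|w - d|).
  have e1 : ip (g x - g y) (- w) = ip (g y - g x) w by rewrite ipNr -ipNl opprB.
  have e2 : ip (g x + g y) (- d) = - ip (g y + g x) d by rewrite ipNr addrC.
  rewrite e1 e2 in h2; lra.
have r0 : 0 <= Num.sqrt (`|w| ^+ 2 + `|d| ^+ 2) by [].
have re : Num.sqrt (`|w| ^+ 2 + `|d| ^+ 2) ^+ 2 = `|w| ^+ 2 + `|d| ^+ 2.
  by rewrite sqr_sqrtr// addr_ge0 ?sqr_ge0.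
have h4 := phi_norm_sum om hip r0 re.
have rt : Num.sqrt (`|w| ^+ 2 + `|d| ^+ 2) <= t.
  rewrite -(ler_pXn2r (_ : 0 < 2)%N) ?nnegrE ?(ltW t0)// re dt.
  have := normr_ge0 w; nra.
have h5 := phi_le om r0 rt; have h6 := phi_le_mul om (ltW t0).
rewrite ew in h3.
have h7 : q * (t / 2) * `|g y - g x| <= C * (2 * (t * omega t)).
  by apply: le_trans h3 _; rewrite ler_pM2l//; lra.
rewrite distrC.
have -> : 4 / q * C * omega t = C * (2 * (t * omega t)) / (q * (t / 2)).
  by field; rewrite !gt_eqF.
by rewrite ler_pdivlMr ?mulr_gt0 ?invr_gt0// mulrC.
Qed.

End Taylor.

(** * The extension *)

Section Extension.
Context (R : realType) (omega : R -> R) (om : is_modulus omega).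
Context (X : completeNormedModType R) (ip : {dot X for idfun}).
Context (hip : induces_norm ip).
Context (E : set X) (hE : E !=set0) (f : X -> R) (G : X -> X).
Context (M : R) (M0 : 0 < M) (W : W1omega ip omega E f G M).
Local Notation phi := (phi omega).
Local Notation paraconvex := (paraconvex omega).

Definition upper (y x : X) := f y + ip (G y) (x - y) + 2 * M * phi `|x - y|.
Definition lower (y x : X) := f y + ip (G y) (x - y) - 2 * M * phi `|x - y|.

(** With v = (y - z) / 2 and w = x - (y + z) / 2 the symmetric form of
    condition W leaves only <G z - G y, w> to be bounded; Young's inequality
    trades it for the conjugate term. *)
Lemma lower_le_upper (y z x : X) : E y -> E z -> lower z x <= upper y x.
Proof.
move=> Ey Ez; pose v := 2^-1 *: (y - z); pose w := x - 2^-1 *: (y + z).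
have vy : v + 2^-1 *: (y + z) = y.
  rewrite /v -scalerDr addrACA addNr addr0.
  exact: half_double.
have zv : z = 2^-1 *: (y + z) - v.
  rewrite /v -scalerBr opprB [y + z]addrC addrACA subrr addr0.
  by rewrite half_double.
have xy : x - y = w - v by rewrite -[in LHS]vy [v + _]addrC opprD addrA.
have xz : x - z = w + v by rewrite [in LHS]zv opprB addrA addrAC.
have vt : `|y - z| = 2 * `|v| by rewrite /v norm_half mulrC divfK ?pnatr_eq0.
have zy : z - y = - (2 *: v).
  by rewrite /v scalerA divff ?pnatr_eq0// scale1r opprB.
have := W Ey Ez; rewrite vt zy /lower /upper xy xz.
have := phi_norm_parallelogram om hip v w.
set D := `|G y - G z|; set P := phi_star _ _ => h1 h2.
have y1 := young om (D / (2 * M)) (normr_ge0 w).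
have {}y1 : D * `|w| <= 2 * M * P + 2 * M * phi `|w|.
  have -> : D * `|w| = 2 * M * (D / (2 * M) * `|w|) by field; rewrite gt_eqF.
  by rewrite -mulrDr ler_pM2l ?mulr_gt0//; rewrite -/P in y1; lra.
have cs : ip (G z - G y) w <= D * `|w|.
  by rewrite /D distrC; exact: ip_le.
rewrite ipDl ipNl in cs; rewrite ipNr ipZr !ipDl in h2.
have h3 := ler_wpM2l (ltW M0) h1.
rewrite (ipDr _ w v) (ipDr _ w (- v)) ipNr; lra.
Qed.

Lemma upper_paraconcave (y : X) : paraconvex (4 * M) (fun x => - upper y x).
Proof.
have M2 : 0 <= 2 * M by rewrite mulr_ge0// ltW.
have := cap_paraconvex om hip (- f y) (- G y) y M2.
have -> : 2 * (2 * M) = 4 * M by ring.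
by congr (paraconvex _ _); apply/funext => x; rewrite /upper ipNl; ring.
Qed.

Lemma lower_paraconvex (y : X) : paraconvex (4 * M) (lower y).
Proof.
have M2 : 0 <= 2 * M by rewrite mulr_ge0// ltW.
have := cap_paraconvex om hip (f y) (G y) y M2.
by have -> : 2 * (2 * M) = 4 * M by ring.
Qed.

Definition admissible (h : X -> R) :=
  paraconvex (4 * M) h /\ forall y x, E y -> h x <= upper y x.

(** This supremum is itself admissible, hence it is the largest admissible
    function. *)
Definition extension (x : X) : R := sup [set h x | h in admissible].

Lemma lower_admissible (y : X) : E y -> admissible (lower y).
Proof.
move=> Ey; split; first exact: lower_paraconvex.
by move=> z x Ez; exact: lower_le_upper.
Qed.

Lemma admissible_le (h : X -> R) (x : X) : admissible h -> h x <= extension x.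
Proof.
move=> ah; apply: ub_le_sup; last by exists h.
by have [y Ey] := hE; exists (upper y x) => _ [k [_ kle] <-]; exact: kle.
Qed.

Lemma extension_le (x : X) (b : R) :
  (forall h, admissible h -> h x <= b) -> extension x <= b.
Proof.
move=> hb; apply: ge_sup; last by move=> _ [h ah <-]; exact: hb.
have [y Ey] := hE; exists (lower y x); exists (lower y) => //.
exact: lower_admissible.
Qed.

Lemma extension_upper (y x : X) : E y -> extension x <= upper y x.
Proof. by move=> Ey; apply: extension_le => h [_]; exact. Qed.

Lemma lower_extension (y x : X) : E y -> lower y x <= extension x.
Proof. by move=> Ey; apply: admissible_le; exact: lower_admissible. Qed.

Lemma extension_paraconvex : paraconvex (4 * M) extension.
Proof.
move=> p d e l l01 z; apply: extension_le => h ah.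
have [hc _] := ah; apply: le_trans (hc _ _ _ _ l01 z) _.
have /andP[l0 l1] := l01.
by apply: lerD; rewrite ler_wpM2l ?subr_ge0// lerD2r admissible_le.
Qed.

(** Averaging translates of the extension by d and e, lowered by the error
    terms, gives an admissible function; its value at p is at most that of the
    extension by maximality. *)
Lemma extension_paraconcave : paraconvex (4 * M) (fun x => - extension x).
Proof.
move=> p d e l l01 z; have /andP[l0 l1] := l01.
have l1' : 0 <= 1 - l by rewrite subr_ge0.
pose h x := l * (extension (x + d) - 4 * M * phi `|d|)
  + (1 - l) * (extension (x + e) - 4 * M * phi `|e|).
suff /(@admissible_le h p) : admissible h by rewrite /h; lra.
split=> [q d' e' m m01 mz|y x Ey].
  have := extension_paraconvex (q + d) m01 mz.
  have := extension_paraconvex (q + e) m01 mz.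
  have /andP[m0 m1] := m01.
  move=> /(ler_wpM2l l1') h1 /(ler_wpM2l l0) h2.
  rewrite /h ![_ + d' + _]addrAC ![_ + e' + _]addrAC; lra.
have := ler_wpM2l l0 (extension_upper (x + d) Ey).
have := ler_wpM2l l1' (extension_upper (x + e) Ey).
have := upper_paraconcave y x l01 z; rewrite /h; lra.
Qed.

Lemma extension_taylor (p : X) : exists v, forall h,
  `|extension (p + h) - extension p - ip v h| <= 4 * M * phi `|h|.
Proof.
have M4 : 0 <= 4 * M by rewrite mulr_ge0// ltW.
have [y Ey] := hE; pose r := `|p - y| + 1.
apply: (paraconvex_taylor om hip M4 extension_paraconvex extension_paraconcave
  (B := `|f y| + `|G y| * r + 2 * M * phi r)) => h h1.
have le := lower_extension (p + h) Ey; have ge := extension_upper (p + h) Ey.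
have xr : `|p + h - y| <= r.
  by rewrite addrAC (le_trans (ler_normD _ _))// lerD2l.
have := phi_le om (normr_ge0 _) xr => h2.
have M2 : 0 <= 2 * M by rewrite mulr_ge0// ltW.
have h3 := ler_wpM2l M2 h2.
have := ip_abs hip (G y) (p + h - y); have := ler_wpM2l (normr_ge0 (G y)) xr.
have := ler_norm (f y); have := ler_norm (- f y); rewrite normrN.
rewrite /lower /upper in le ge.
rewrite !ler_norml => h4 h5 h6 /andP[h7 h8]; apply/andP; split; lra.
Qed.

Lemma upper_diag (y : X) : upper y y = f y.
Proof. by rewrite /upper subrr linear0r normr0 phi0 mulr0 !addr0. Qed.

Lemma lower_diag (y : X) : lower y y = f y.
Proof. by rewrite /lower subrr linear0r normr0 phi0 mulr0 subr0 addr0. Qed.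

Lemma extension_eq (y : X) : E y -> extension y = f y.
Proof.
move=> Ey; apply/eqP; rewrite eq_le.
by rewrite -{1}(upper_diag y) extension_upper// -(lower_diag y) lower_extension.
Qed.

Lemma extension_grad (y : X) : E y -> grad ip extension y = G y.
Proof.
move=> Ey; suff bound h :
    `|extension (y + h) - extension y - ip (G y) h| <= 2 * M * phi `|h|.
  by have [] := taylor_differentiable hip om bound.
rewrite (extension_eq Ey).
have := extension_upper (y + h) Ey; have := lower_extension (y + h) Ey.
rewrite /upper /lower [y + h]addrC addrK ler_norml => *.
by apply/andP; split; lra.
Qed.

Lemma extension_taylor_bound :
  (forall x, differentiable extension x) /\
  taylor_bound omega ip (4 * M) extension (grad ip extension).
Proof.
have h x : differentiable extension x /\ forall h,
    `|extension (x + h) - extension x - ip (grad ip extension x) h|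
      <= 4 * M * phi `|h|.
  have [v hv] := extension_taylor x.
  by have [d ->] := taylor_differentiable hip om hv.
by split=> x; case: (h x).
Qed.

End Extension.

Theorem theorem1p3 (R : realType) (omega : R -> R)
    (homega : is_modulus omega)
    (X : completeNormedModType R) (ip : {dot X for idfun})
    (hip : induces_norm ip)
    (E : set X) (hE : E !=set0) (f : X -> R) (G : X -> X) :
  ((exists F : X -> R, C1omega ip omega F /\
      forall x, E x -> F x = f x /\ grad ip F x = G x) <->
   (exists M : R, 0 < M /\ W1omega ip omega E f G M)) /\
  (forall M : R, 0 < M -> W1omega ip omega E f G M ->
    exists F : X -> R,
      [/\ C1omega ip omega F,
          forall x, E x -> F x = f x /\ grad ip F x = G x &
          (M_omega omega setT (grad ip F) <= (16 / Num.sqrt 3 * M)%:E)%E]).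
Proof.
have suf M : 0 < M -> W1omega ip omega E f G M -> exists F : X -> R,
      [/\ C1omega ip omega F,
          forall x, E x -> F x = f x /\ grad ip F x = G x &
          (M_omega omega setT (grad ip F) <= (16 / Num.sqrt 3 * M)%:E)%E].
  move=> M0 W; pose F := extension omega ip E f G M.
  have [dF tF] := extension_taylor_bound homega hip hE M0 W.
  have M4 : 0 < 4 * M by rewrite mulr_gt0.
  have gF x y : `|grad ip F x - grad ip F y|
      <= 16 / Num.sqrt 3 * M * omega `|x - y|.
    have := taylor_grad_modulus homega hip M4 tF x y.
    by congr (_ <= _ * _); ring.
  exists F; split.
  - split=> //; exists (16 / Num.sqrt 3 * M); split=> //.
    by rewrite mulr_gt0// divr_gt0// sqrtr_gt0.
  - by move=> x Ex; split; [exact: extension_eq|exact: extension_grad].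
  - apply: ge_ereal_sup => _ [x [y [_ _ xy ->]]]; rewrite lee_fin.
    rewrite ler_pdivrMr//; apply: modulus_gt0 => //.
    by rewrite normr_gt0 subr_eq0; apply/eqP.
split=> //; split=> [[F [CF FE]]|[M [M0 W]]]; last first.
  by have [F [CF FE _]] := suf M M0 W; exists F.
have [C C0 tC] := C1omega_taylor homega hip CF.
exists C; split=> // y z Ey Ez.
have [<- <-] := FE y Ey; have [<- <-] := FE z Ez.
exact: (taylor_W1omega homega hip C0 tC (E := E)).
Qed.
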